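(* Let $R$ be a ring. Then $R$ is Yaqub nil-clean if and only if $R$ is isomorphic to one of $R_1$, $R_2$, $R_3$, $R_1\times R_2$ or $R_1\times R_3$, for some rings $R_1,R_2,R_3$ such that (1) $R_1/J(R_1)$ is Boolean and $J(R_1)$ is nil; (2) $R_2/J(R_2)$ is a Yaqub ring and $J(R_2)$ is nil; (3) $R_3/J(R_3)\cong \mathbb{Z}_5$ and $J(R_3)$ is nil.
   Context: All rings are associative with identity, not necessarily commutative. $J(R)$ denotes the Jacobson radical of $R$; it is nil if each of its elements is nilpotent. $\mathbb{Z}_n$ denotes $\mathbb{Z}/n\mathbb{Z}$. A ring $R$ is Yaqub nil-clean if for every $a\in R$, $a+a^3$ is nilpotent or $a-a^3$ is nilpotent. A ring is Boolean if $x^2=x$ for all its elements $x$. A ring is a Yaqub ring if it is a subdirect product of copies of $\mathbb{Z}_3$ (i.e. isomorphic to a subring of a direct product of copies of $\mathbb{Z}_3$ that projects onto each factor). *)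

(* Defs.v *)
From HB Require Import structures.
From mathcomp Require Import all_boot all_algebra.
From mathcomp Require Import boolp classical_sets functions.

Set Implicit Arguments.
Unset Strict Implicit.
Unset Printing Implicit Defensive.

Import GRing.Theory.
Local Open Scope classical_set_scope.
Local Open Scope ring_scope.

(* pzRingType: the zero ring is allowed. *)
Definition nilpotent (R : pzRingType) (x : R) : Prop :=
  exists n : nat, x ^+ n = 0.

Definition yaqub_nil_clean (R : pzRingType) : Prop :=
  forall a : R, nilpotent (a + a ^+ 3) \/ nilpotent (a - a ^+ 3).

Definition ring_isomorphic (R S : pzRingType) : Prop :=
  exists f : {rmorphism R -> S}, bijective f.

Definition boolean_ring (R : pzRingType) : Prop :=
  forall x : R, x ^+ 2 = x.

(* The subring of the product ring I -> 'Z_3 is the image of f; I may be empty,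
   so the zero ring is included. *)
Definition yaqub_ring (R : pzRingType) : Prop :=
  exists (I : Type) (f : {rmorphism R -> (I -> 'Z_3)}),
    injective f /\ forall (i : I) (c : 'Z_3), exists x : R, f x i = c.

Definition left_ideal (R : pzRingType) (I : set R) : Prop :=
  [/\ I 0,
      forall x y : R, I x -> I y -> I (x - y)
    & forall a x : R, I x -> I (a * x)].

Definition maximal_left_ideal (R : pzRingType) (M : set R) : Prop :=
  [/\ left_ideal M,
      M <> setT
    & forall I : set R, left_ideal I -> M `<=` I -> I = M \/ I = setT].

Definition jacobson (R : pzRingType) : {pred R} :=
  fun x => `[< forall M : set R, maximal_left_ideal M -> M x >].
Arguments jacobson : clear implicits.

Definition nil_jacobson (R : pzRingType) : Prop :=
  forall x : R, x \in jacobson R -> nilpotent x.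

Section JacobsonIdeal.
Variable R : pzRingType.

Lemma jacobsonP (x : R) :
  reflect (forall M : set R, maximal_left_ideal M -> M x) (x \in jacobson R).
Proof. exact: asboolP. Qed.

Lemma jacobson_zmod_closed : zmod_closed (jacobson R).
Proof.
split; first by apply/jacobsonP => M [[]].
move=> x y /jacobsonP Jx /jacobsonP Jy; apply/jacobsonP => M maxM.
by case: (maxM) => [[_ MB _] _ _]; apply: MB; [exact: Jx | exact: Jy].
Qed.

HB.instance Definition _ :=
  GRing.isZmodClosed.Build R (jacobson R) jacobson_zmod_closed.

Lemma jacobsonMl (a x : R) : x \in jacobson R -> a * x \in jacobson R.
Proof.
move=> /jacobsonP Jx; apply/jacobsonP => M maxM.
by case: (maxM) => [[_ _ MZ] _ _]; apply: MZ; exact: Jx.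
Qed.

Lemma left_ideal1 (I : set R) : left_ideal I -> I 1 -> I = setT.
Proof.
move=> [_ _ IZ] I1; apply/seteqP; split=> // x _.
by rewrite -[x]mulr1; exact: IZ.
Qed.

Lemma left_idealD (I : set R) (x y : R) :
  left_ideal I -> I x -> I y -> I (x + y).
Proof.
move=> [I0 IB _] Ix Iy; rewrite -[y]opprK; apply: (IB) => //.
by rewrite -[- y]add0r; exact: IB.
Qed.

(* If r is not in M, then (M : r) is again a maximal left ideal. *)
Lemma maximal_left_ideal_colon (M : set R) (r : R) :
  maximal_left_ideal M -> ~ M r ->
  maximal_left_ideal [set x | M (x * r)].
Proof.
move=> [idM _ maxM] nMr; have [M0 MB MZ] := idM; split.
- split=> /= [|x y Mx My|a x Mx]; first by rewrite mul0r.
    by rewrite mulrBl; exact: MB.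
  by rewrite -mulrA; exact: MZ.
- by move=> NT; apply: nMr; have : setT (1 : R) by []; rewrite -NT /= mul1r.
move=> L idL NL; have [L0 LB LZ] := idL.
have [LN|/existsNP[l /not_implyP[Ll nMlr]]] :=
    pselect (forall l, L l -> M (l * r)).
  by left; apply/seteqP.
right; apply: left_ideal1 => //.
pose K := [set z | exists s, exists2 m, M m & z = s * (l * r) + m].
have idK : left_ideal K.
  split=> [|_ _ [s [m Mm ->]] [t [n Mn ->]]|a _ [s [m Mm ->]]].
  - by exists 0, 0 => //; rewrite mul0r addr0.
  - exists (s - t), (m - n); first exact: MB.
    by rewrite mulrBl opprD addrACA.
  - exists (a * s), (a * m); first exact: MZ.
    by rewrite mulrDr !mulrA.
have [|KM|KT] := maxM K idK.
- by move=> m Mm; exists 0, m => //; rewrite mul0r add0r.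
- case: nMlr; rewrite -KM; exists 1, 0 => //.
  by rewrite mul1r addr0.
have [s [m Mm rE]] : K r by rewrite KT.
have Lsl : L (1 - s * l).
  by apply: NL; rewrite /= mulrBl mul1r -mulrA {1}rE addrAC subrr add0r.
rewrite -(subrK (s * l) 1); apply: left_idealD => //; exact: LZ.
Qed.

Lemma jacobsonMr (x r : R) : x \in jacobson R -> x * r \in jacobson R.
Proof.
move=> /jacobsonP Jx; apply/jacobsonP => M maxM.
have [Mr|nMr] := pselect (M r).
  by case: maxM => [[_ _ MZ] _ _]; exact: MZ.
by have /Jx := maximal_left_ideal_colon maxM nMr.
Qed.

End JacobsonIdeal.

(* R / J(R).  The library gives this quotient its additive structure only
   (its quotient rings are commutative), so the product is added below. *)
Definition jquot (R : pzRingType) : Type := Quotient.quot (jacobson R).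

Section JacobsonQuotient.
Variable R : pzRingType.
Local Open Scope quotient_scope.
Local Notation Q := (jquot R).

HB.instance Definition _ := Quotient.on Q.
HB.instance Definition _ := GRing.Zmodule.on Q.

Definition jpi (x : R) : Q := \pi_Q x.
Definition jone : Q := jpi 1.
Definition jmul (u v : Q) : Q := jpi (repr u * repr v).

Lemma jpi_eq (x y : R) : (jpi x == jpi y) = (x - y \in jacobson R).
Proof. exact/esym/(Quotient.idealrBE (jacobson R)). Qed.

Lemma jpi_repr (u : Q) : jpi (repr u) = u.
Proof. exact: reprK. Qed.

Lemma jpi_is_zmod_morphism : zmod_morphism jpi.
Proof. by move=> x y; rewrite /jpi !piE. Qed.

HB.instance Definition _ :=
  GRing.isZmodMorphism.Build R Q jpi jpi_is_zmod_morphism.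

Lemma jpiM (x y : R) : jpi (x * y) = jmul (jpi x) (jpi y).
Proof.
apply/eqP; rewrite jpi_eq; set x' := repr (jpi x); set y' := repr (jpi y).
have Jx : x - x' \in jacobson R by rewrite -jpi_eq jpi_repr.
have Jy : y - y' \in jacobson R by rewrite -jpi_eq jpi_repr.
have -> : x * y - x' * y' = (x - x') * y + x' * (y - y').
  by rewrite mulrBl mulrBr addrA subrK.
by apply: rpredD; [exact: jacobsonMr | exact: jacobsonMl].
Qed.

Lemma jmulA : associative jmul.
Proof.
by move=> u v w; rewrite -(jpi_repr u) -(jpi_repr v) -(jpi_repr w) -!jpiM mulrA.
Qed.

Lemma jmul1l : left_id jone jmul.
Proof. by move=> u; rewrite -(jpi_repr u) -jpiM mul1r. Qed.

Lemma jmul1r : right_id jone jmul.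
Proof. by move=> u; rewrite -(jpi_repr u) -jpiM mulr1. Qed.

Lemma jmulDl : left_distributive jmul +%R.
Proof.
move=> u v w; rewrite -(jpi_repr u) -(jpi_repr v) -(jpi_repr w).
by rewrite -raddfD -!jpiM mulrDl raddfD.
Qed.

Lemma jmulDr : right_distributive jmul +%R.
Proof.
move=> u v w; rewrite -(jpi_repr u) -(jpi_repr v) -(jpi_repr w).
by rewrite -raddfD -!jpiM mulrDr raddfD.
Qed.

HB.instance Definition _ := GRing.Zmodule_isPzRing.Build Q
  jmulA jmul1l jmul1r jmulDl jmulDr.

Lemma jpi_is_monoid_morphism : monoid_morphism jpi.
Proof. by split=> [|x y]; [|exact: jpiM]. Qed.

HB.instance Definition _ :=
  GRing.isMonoidMorphism.Build R Q jpi jpi_is_monoid_morphism.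

End JacobsonQuotient.

(* Main.v *)
Require Import Defs.
From HB Require Import structures.
From mathcomp Require Import all_boot all_algebra.
From mathcomp Require Import boolp classical_sets functions.

(** Why the theorem is true.

    Taking a = 2 in the defining condition shows that 10 or 6 is nilpotent in a
    Yaqub nil-clean ring R.  A Bezout relation between powers of the two prime
    factors gives a central idempotent, hence a Peirce decomposition of R into
    a factor where 2 is nilpotent and a factor where 3, respectively 5, is
    nilpotent ([peirce_coprime], [peirce_isomorphic]).  Each factor is a
    homomorphic image of R, so it is again Yaqub nil-clean.

    The core of the proof is that in a Yaqub nil-clean ring the Jacobson radical
    J is exactly the set of nilpotent elements.  Elements of J are nilpotent
    because x + x^3 and x - x^3 are x times a unit when x is in J.  For the
    converse it suffices that x^2 in J implies x in J
    ([yaqub_nil_clean_sqr_jacobson]).  If x avoids some maximal left ideal M,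
    then x acts on the simple module R/M as a nonzero map of square zero, and
    from x and an element inverting it modulo M one builds elements of R that
    realize all integer 2x2 matrices on the span of the classes of 1 and x
    ([span2_of_sqr_jacobson]); this replaces the structure theory of primitive
    rings.  The matrix A with rows (7, 1) and (1, 0) satisfies
    det (A + A^3) = -53 and det (A - A^3) = 49.  The Yaqub condition makes one
    of the two nilpotent on R/M, so a power of 53 or of 49 lies in M; but a
    power of 30 is zero in R and 30 is prime to both numbers, so 1 would be
    in M.

    Consequently S = R/J is reduced and u^3 = u or u^3 = -u for each u in S,
    and if the prime p is nilpotent in R then p = 0 in S.
    - If p = 2, then (u^2 - u)^2 = 0, so S is Boolean.
    - If p = 3, then u^3 = u; squares are central idempotents, so every maximal
      left ideal is two-sided, and u (u - 1) (u + 1) = 0 makes its residue ring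
      Z_3.  These residue maps together embed S in a power of Z_3.
    - If p = 5, applying the condition to e + 1 for an idempotent e forces e = 0
      or e = 1, and applying this to e = u^4 gives S = {0, 1, 2, 3, 4} unless
      S is zero.  If the 5-part of R is zero, R itself is its 2-part.

    The converse is a verification in R/J, where nil radicals lift the
    identities u^3 = u and u^3 = -u to the nilpotence of x - x^3
    and x + x^3. *)

Set Implicit Arguments.
Unset Strict Implicit.
Unset Printing Implicit Defensive.

Import GRing.Theory.
Local Open Scope classical_set_scope.
Local Open Scope ring_scope.

(** * Left ideals and the Jacobson radical *)

Section LeftIdeals.
Variables (R : pzRingType) (L : set R).
Hypothesis idL : left_ideal L.

Lemma left_idealN x : L x -> L (- x).
Proof. by case: idL => L0 LB _ Lx; rewrite -[- x]sub0r; apply: LB. Qed.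

Lemma left_ideal_sum (I : Type) (s : seq I) (F : I -> R) :
  (forall i, L (F i)) -> L (\sum_(i <- s) F i).
Proof.
move=> LF; apply: (big_ind L) => [|x y Lx Ly|i _] //; first by case: idL.
exact: left_idealD.
Qed.

Lemma left_idealMz x k : L x -> L (x *~ k).
Proof. by case: idL => _ _ LZ Lx; rewrite -mulrzl; apply: LZ. Qed.

Lemma left_ideal_congr x y : L (x - y) -> L y -> L x.
Proof. by move=> Lxy Ly; rewrite -(subrK y x); apply: left_idealD. Qed.

End LeftIdeals.

(** Zorn's lemma is applied to the left ideals that contain L and avoid 1,
    together with the empty set, which is the union of the empty chain. *)
Lemma left_ideal_sub_maximal (R : pzRingType) (L : set R) :
  left_ideal L -> ~ L 1 -> exists2 M, maximal_left_ideal M & L `<=` M.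
Proof.
move=> idL nL1.
pose P (A : set R) := A = set0 \/ [/\ left_ideal A, ~ A 1 & L `<=` A].
have [F FP totF|M [PM Mmax]] := @Zorn_bigcup R P.
  have [[A0 FA0 /set0P[x0 A0x0]]|F0] :=
      pselect (exists2 A, F A & A != set0); last first.
    left; apply/seteqP; split=> // x [A FA Ax]; apply: F0.
    by exists A => //; apply/set0P; exists x.
  have FPx A x : F A -> A x -> [/\ left_ideal A, ~ A 1 & L `<=` A].
    by move=> FA Ax; case: (FP A FA) => // AE; move: Ax; rewrite AE.
  have [idA0 _ LA0] := FPx _ _ FA0 A0x0.
  right; split; last 1 first.
  - by move=> x Lx; exists A0 => //; exact: LA0.
  - split.
    + by exists A0 => //; case: idA0.
    + move=> x y [A FA Ax] [B FB By].
      have [idA _ _] := FPx _ _ FA Ax; have [idB _ _] := FPx _ _ FB By.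
      have [AB|BA] := totF A B FA FB.
        by exists B => //; case: idB => _ LB _; apply: LB => //; exact: AB.
      by exists A => //; case: idA => _ LB _; apply: LB => //; exact: BA.
    + move=> a x [A FA Ax]; have [[_ _ AZ] _ _] := FPx _ _ FA Ax.
      by exists A => //; exact: AZ.
  - by case=> A FA A1; have [_ /(_ A1)] := FPx _ _ FA A1.
have L0 : L 0 by case: idL.
have [idM nM1 LM] : [/\ left_ideal M, ~ M 1 & L `<=` M].
  case: PM => // M0; case: (Mmax L); last by right; split.
  by rewrite M0; split=> // L_0; have := L_0 0 L0.
exists M => //; split=> // [MT|N idN MN]; first by apply: nM1; rewrite MT.
have [N1|nN1] := pselect (N 1); [by right; exact: left_ideal1 | left].
apply: contrapT => NM; apply: (Mmax N).
  by split=> // NsubM; apply: NM; apply/seteqP.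
by right; split=> // x /LM /MN.
Qed.

Section Maximal.
Variables (R : pzRingType) (M : set R).
Hypothesis maxM : maximal_left_ideal M.

Lemma maximal_left_ideal_id : left_ideal M. Proof. by case: maxM. Qed.

Lemma maximal_left_ideal_not1 : ~ M 1.
Proof.
by move=> M1; case: maxM => idM nMT _; apply: nMT; apply: left_ideal1.
Qed.

Lemma maximal_left_ideal_inv x : ~ M x -> exists r, M (r * x - 1).
Proof.
move=> nMx; case: maxM => idM _ Mmax; have [M0 MB MZ] := idM.
(* K is the left ideal M + R x. *)
pose K := [set z | exists s, M (z - s * x)].
have [||KM|KT] := Mmax K.
- split; first by exists 0; rewrite mul0r subr0.
    move=> y z [s Ms] [t Mt]; exists (s - t).
    have -> : y - z - (s - t) * x = (y - s * x) - (z - t * x).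
      by rewrite mulrBl !opprD addrACA.
    exact: MB.
  by move=> a y [s Ms]; exists (a * s); rewrite -mulrA -mulrBr; apply: MZ.
- by move=> y My; exists 0; rewrite mul0r subr0.
- by case: nMx; rewrite -KM; exists 1; rewrite mul1r subrr.
have [s Ms] : K 1 by rewrite KT.
by exists s; rewrite -opprB; apply: left_idealN.
Qed.

Lemma jacobson_sub_maximal x : x \in jacobson R -> M x.
Proof. by move/jacobsonP; apply. Qed.

End Maximal.

(** Otherwise R (1 + y) would lie in a maximal left ideal, which contains y
    and hence 1. *)
Lemma jacobson_linv (R : pzRingType) (y : R) :
  y \in jacobson R -> exists u, u * (1 + y) = 1.
Proof.
move=> Jy; pose L := [set z | exists u, z = u * (1 + y)].
have idL : left_ideal L.
  split; first by exists 0; rewrite mul0r.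
    by move=> _ _ [u ->] [v ->]; exists (u - v); rewrite mulrBl.
  by move=> a _ [u ->]; exists (a * u); rewrite mulrA.
have [[u]|nL1] := pselect (L 1); first by exists u.
have [M maxM LM] := left_ideal_sub_maximal idL nL1.
case: (maximal_left_ideal_not1 maxM); rewrite -(addrK y 1).
case: (maximal_left_ideal_id maxM) => _ MB _; apply: MB.
  by apply: LM; exists 1; rewrite mul1r.
exact: jacobson_sub_maximal Jy.
Qed.

(** 1 + y is left invertible, and so are its powers: they stay in 1 + J.
    Since x commutes with them, they can be cancelled from
    (x (1 + y))^n = 0. *)
Lemma nilpotent_jacobson_factor (R : pzRingType) (x y : R) :
  y \in jacobson R -> GRing.comm x y -> nilpotent (x + x * y) -> nilpotent x.
Proof.
move=> Jy cxy [n]; rewrite -{1}[x]mulr1 -mulrDr => xy0; exists n.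
have c1y : GRing.comm x (1 + y) by apply: commrD => //; exact: commr1.
have [z Jz yE] : exists2 z, z \in jacobson R & (1 + y) ^+ n = 1 + z.
  elim: n {xy0} => [|n [z Jz yE]]; first by exists 0; rewrite ?rpred0 ?addr0.
  exists (y + z * (1 + y)); first by rewrite rpredD // jacobsonMr.
  by rewrite exprSr yE mulrDl mul1r addrA.
have [u uz1] := jacobson_linv Jz.
have cn : GRing.comm (x ^+ n) ((1 + y) ^+ n).
  by apply/commr_sym/commrX/commr_sym/commrX.
rewrite -[x ^+ n]mul1r -uz1 -yE -mulrA -cn.
by rewrite -exprMn_comm // xy0 mulr0.
Qed.

Lemma yaqub_nil_jacobson (R : pzRingType) :
  yaqub_nil_clean R -> nil_jacobson R.
Proof.
move=> ycR x Jx; have cx : GRing.comm x (x ^+ 2) by apply: commrX.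
have Jxx : x ^+ 2 \in jacobson R by rewrite expr2 jacobsonMl.
case: (ycR x) => nx.
  by apply: (nilpotent_jacobson_factor Jxx) => //; rewrite -exprS.
apply: (@nilpotent_jacobson_factor _ _ (- x ^+ 2)).
- by rewrite rpredN.
- exact: commrN.
- by rewrite mulrN -exprS.
Qed.

(** * Matrices acting on a simple module *)

Section ActsAs.
Variables (R : pzRingType) (M : set R) (n : nat) (b : 'I_n.+1 -> R).
Hypothesis idM : left_ideal M.

(** The j-th column of A lists the coefficients of h b_j modulo M, so that
    products of elements correspond to products of matrices. *)
Definition acts_as (h : R) (A : 'M[int]_n.+1) :=
  forall j, M (h * b j - \sum_i b i *~ A i j).

Lemma acts_as1 : acts_as 1 1.
Proof.
move=> j; rewrite mul1r (bigD1 j) //= big1 => [|i /negPf ij].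
  by rewrite !mxE eqxx mulr1z addr0 subrr; case: idM.
by rewrite !mxE ij mulr0z.
Qed.

Lemma acts_asD g h A B : acts_as g A -> acts_as h B -> acts_as (g + h) (A + B).
Proof.
move=> gA hB j; under eq_bigr do rewrite mxE mulrzDr.
by rewrite big_split mulrDl opprD addrACA; apply: left_idealD.
Qed.

Lemma acts_asN g A : acts_as g A -> acts_as (- g) (- A).
Proof.
move=> gA j; under eq_bigr do rewrite mxE mulrNz.
by rewrite sumrN mulNr -opprD; apply: left_idealN.
Qed.

Lemma acts_asM g h A B : acts_as g A -> acts_as h B -> acts_as (g * h) (A * B).
Proof.
move=> gA hB j.
have sumE : \sum_i (g * b i - \sum_k b k *~ A k i) *~ B i j =
    g * (\sum_i b i *~ B i j) - \sum_k b k *~ (A * B) k j.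
  under eq_bigr do rewrite mulrzBl mulrz_suml -mulrzAr.
  rewrite sumrB -mulr_sumr; congr (_ - _).
  rewrite exchange_big /=; apply: eq_bigr => k _.
  by rewrite mxE mulrz_sumr; apply: eq_bigr => i _; rewrite mulrzA.
have -> : g * h * b j - \sum_k b k *~ (A * B) k j =
    g * (h * b j - \sum_i b i *~ B i j)
    + \sum_i (g * b i - \sum_k b k *~ A k i) *~ B i j.
  by rewrite sumE mulrBr mulrA addrA subrK.
apply: left_idealD => //; first by case: idM => _ _; apply.
by apply: left_ideal_sum => // i; apply: left_idealMz.
Qed.

Lemma acts_asX g A k : acts_as g A -> acts_as (g ^+ k) (A ^+ k).
Proof.
move=> gA; elim: k => [|k IHk]; first exact: acts_as1.
by rewrite !exprS; apply: acts_asM.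
Qed.

(** It is enough to realize the matrix units. *)
Lemma acts_as_span (E : 'I_n.+1 -> 'I_n.+1 -> R) :
  (forall i k j, M (E i k * b j - b i *+ (k == j))) ->
  forall A : 'M[int]_n.+1, acts_as (\sum_i \sum_k E i k *~ A i k) A.
Proof.
move=> EM A j; rewrite mulr_suml -sumrB; apply: left_ideal_sum => // i.
have -> : b i *~ A i j = \sum_k b i *+ (k == j) *~ A i k.
  rewrite (bigD1 j) //= eqxx big1 ?addr0 // => k /negPf ->.
  by rewrite mulr0n mul0rz.
rewrite mulr_suml -sumrB; apply: left_ideal_sum => // k.
by rewrite mulrzAl -mulrzBl; apply: left_idealMz.
Qed.

(** If h acts as A with h^k = 0, and g acts as the adjugate of A, then
    g^k h^k = 0 acts as the scalar (det A)^k, which therefore kills b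
    modulo M.  A commutes with its adjugate although g and h need
    not commute. *)
Lemma acts_as_nilpotent :
  (forall A, exists h, acts_as h A) ->
  forall h A, acts_as h A -> nilpotent h ->
  exists k, forall j, M (b j *~ (\det A ^+ k)).
Proof.
move=> span h A hA [k hk0]; exists k => j; have [g gA] := span (\adj A).
have := acts_asM (acts_asX k gA) (acts_asX k hA).
have /exprMn_comm <- : GRing.comm (\adj A) A.
  by rewrite /GRing.comm -!mulmxE mul_adj_mx mul_mx_adj.
rewrite -mulmxE mul_adj_mx hk0 mulr0 -rmorphXn /= => /(_ j).
rewrite mul0r sub0r (bigD1 j) //= big1 => [|i /negPf ij]; last first.
  by rewrite mxE ij mulr0n mulr0z.
by rewrite mxE eqxx addr0 mulr1n => /(left_idealN idM); rewrite opprK.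
Qed.

End ActsAs.

Lemma left_ideal_coprime (R : pzRingType) (L : set R) (m n : int) :
  left_ideal L -> coprimez m n -> L (m%:~R) -> L (n%:~R) -> L 1.
Proof.
move=> idL /coprimezP[[u v] /= uv1] Lm Ln; case: (idL) => _ _ LZ.
rewrite -[1]/(1%:~R) -uv1 rmorphD !rmorphM /=.
by apply: left_idealD => //; apply: LZ.
Qed.

Lemma yaqub_nil_clean_6_or_10 (R : pzRingType) :
  yaqub_nil_clean R -> nilpotent (6%:R : R) \/ nilpotent (10%:R : R).
Proof.
move=> /(_ 2%:R); rewrite -natrX -natrD => -[n10|[k]]; first by right.
rewrite -opprB -natrB // -[(2 ^ 3 - 2)%N]/6%N exprNn => k0; left; exists k.
by rewrite -[LHS](signrMK k) k0 mulr0.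
Qed.

(** Choose r with r x = 1 modulo M and correct it to s = r - r (r x), so that s
    kills 1 and maps x to 1 modulo M, while x maps 1 to x and kills x.  Then
    s x, s, x and 1 - s x are the matrix units for the family (1, x). *)
Lemma span2_of_sqr_jacobson (R : pzRingType) (M : set R) (x : R) :
  maximal_left_ideal M -> ~ M x -> x * x \in jacobson R ->
  exists2 b : 'I_2 -> R, b 0 = 1 & forall A, exists h, acts_as M b h A.
Proof.
move=> maxM nMx Jxx.
have idM := maximal_left_ideal_id maxM; have [M0 MB MZ] := idM.
have [r Mr] := maximal_left_ideal_inv maxM nMx.
pose s := r - r * (r * x).
have Ms : M s.
  rewrite /s -[X in X - _]mulr1 -mulrBr -opprB mulrN.
  by apply: left_idealN => //; apply: MZ.
have Mxx y : M (y * x * x).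
  by rewrite -mulrA; apply: MZ; apply: jacobson_sub_maximal Jxx.
have Msx : M (s * x - 1).
  by rewrite /s mulrBl addrAC; apply: MB => //; rewrite mulrA; apply: Mxx.
pose b (j : 'I_2) : R := if j == 0 then 1 else x.
pose E (i k : 'I_2) : R :=
  if i == 0 then if k == 0 then s * x else s
  else if k == 0 then x else 1 - s * x.
have EM i k j : M (E i k * b j - b i *+ (k == j)).
  rewrite /E /b; case: i k j => -[|[|//]] ? [[|[|//]] ?] [[|[|//]] ?];
    rewrite /= ?mulr1 ?subr0 ?subrr //.
  - by rewrite -[X in M X]mul1r mulrA; apply: Mxx.
  - by rewrite -opprB; apply: left_idealN.
  - by rewrite mulr1n mulrBl mul1r addrC addKr; apply: left_idealN.
exists b => // A; exists (\sum_i \sum_k E i k *~ A i k).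
exact: acts_as_span.
Qed.

Lemma det2E (A : 'M[int]_2) : \det A = A 0 0 * A 1 1 - A 0 1 * A 1 0.
Proof.
rewrite (expand_det_row _ 0) !big_ord_recl big_ord0 /cofactor !det_mx11 !mxE /=.
rewrite /bump /= expr0 mul1r expr1 mulN1r addr0 mulrN.
by congr (_ * A _ _ - A _ _ * A _ _); apply: val_inj.
Qed.

(** Modulo 2 and 3 the characteristic polynomial t^2 - 7 t - 1 of the matrix A
    with rows (7, 1) and (1, 0) is
    t^2 - t - 1, and modulo 5 it is t^2 - 2 t - 1.  It has no root in common
    with t (1 + t^2) (1 - t^2) modulo any of the three primes, so one integer
    matrix serves all characteristics that can occur. *)
Lemma yaqub_nil_clean_sqr_jacobson (R : pzRingType) (x : R) :
  yaqub_nil_clean R -> x * x \in jacobson R -> x \in jacobson R.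
Proof.
move=> ycR Jxx; apply/jacobsonP => M maxM; apply: contrapT => nMx.
have idM := maximal_left_ideal_id maxM.
apply: (maximal_left_ideal_not1 maxM).
have [b b0 span] := span2_of_sqr_jacobson maxM nMx Jxx.
pose A : 'M[int]_2 :=
  \matrix_(i, j) (7 *+ ((i == 0) && (j == 0)) + (i != j)%:R).
have [h hA] := span A.
have [m n30] : nilpotent (30%:R : R).
  have [[m m0]|[m m0]] := yaqub_nil_clean_6_or_10 ycR; exists m.
    rewrite -[30%N]/(5 * 6)%N natrM exprMn_comm ?m0 ?mulr0 //.
    exact: commr_nat.
  rewrite -[30%N]/(3 * 10)%N natrM exprMn_comm ?m0 ?mulr0 //.
  exact: commr_nat.
suff [d [k [d30 Mdk]]] : exists d k, coprimez d 30 /\ M ((d ^+ k)%:~R).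
  apply: (@left_ideal_coprime _ _ (d ^+ k) (30 ^+ m)) => //.
    by rewrite coprimezXl ?coprimezXr.
  by rewrite rmorphXn /= n30; case: idM.
have detP : \det (A + A ^+ 3) = -53.
  rewrite !det2E !exprS expr0 !mxE.
  by do 3! rewrite ?big_ord_recl ?big_ord0 ?mxE /=.
have detN : \det (A - A ^+ 3) = 49.
  rewrite !det2E !exprS expr0 !mxE.
  by do 3! rewrite ?big_ord_recl ?big_ord0 ?mxE /=.
case: (ycR h) => hk.
  have [k] :=
    acts_as_nilpotent idM span (acts_asD idM hA (acts_asX idM 3 hA)) hk.
  by move=> /(_ 0); rewrite b0 detP => Mk; exists (-53), k.
have [k] := acts_as_nilpotent idM span
  (acts_asD idM hA (acts_asN idM (acts_asX idM 3 hA))) hk.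
by move=> /(_ 0); rewrite b0 detN => Mk; exists 49, k.
Qed.

(** * The quotient by the Jacobson radical *)

Section JacobsonQuotientOfYaqub.
Variable R : pzRingType.
Hypothesis ycR : yaqub_nil_clean R.

Lemma nilpotent_in_jacobson (x : R) : nilpotent x -> x \in jacobson R.
Proof.
case=> n xn0.
have : x ^+ (2 ^ n) \in jacobson R.
  have /ltnW/subnKC <- := ltn_expl n (isT : (1 < 2)%N).
  by rewrite exprD xn0 mul0r rpred0.
elim: n {xn0} => [|n IHn]; first by rewrite expr1.
rewrite expnSr exprM expr2 => /(yaqub_nil_clean_sqr_jacobson ycR); exact: IHn.
Qed.

Lemma jpi_eq0 (x : R) : (jpi x == 0) = (x \in jacobson R).
Proof. by rewrite -(raddf0 (@jpi R)) jpi_eq subr0. Qed.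

Lemma jquot_cube (u : jquot R) : u ^+ 3 = u \/ u ^+ 3 = - u.
Proof.
rewrite -(jpi_repr u) -rmorphXn /= -raddfN /=.
case: (ycR (repr u)) => /nilpotent_in_jacobson Ju; [right|left]; apply/eqP.
  by rewrite jpi_eq opprK addrC.
by rewrite eq_sym jpi_eq.
Qed.

Lemma jquot_reduced (u : jquot R) : u * u = 0 -> u = 0.
Proof.
rewrite -(jpi_repr u) -rmorphM /= => /eqP; rewrite jpi_eq0 => Juu.
by apply/eqP; rewrite jpi_eq0; apply: yaqub_nil_clean_sqr_jacobson.
Qed.

Lemma jquot_natr0 p : nilpotent (p%:R : R) -> p%:R = 0 :> jquot R.
Proof.
move=> /nilpotent_in_jacobson Jp; apply/eqP.
by rewrite -(rmorph_nat (@jpi R)) jpi_eq0.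
Qed.

End JacobsonQuotientOfYaqub.

(** * Rings in which the cube of u is u or its opposite *)

Section CubeRings.
Variable S : pzRingType.
Hypothesis cubeS : forall u : S, u ^+ 3 = u \/ u ^+ 3 = - u.
Hypothesis redS : forall u : S, u * u = 0 -> u = 0.

Lemma natr_mul0 n (u : S) : n%:R = 0 :> S -> u *+ n = 0.
Proof. by move=> n0; rewrite -mulr_natr n0 mulr0. Qed.

(** In a reduced ring e y (1 - e) and (1 - e) y e have square zero, so both
    e y and y e equal e y e. *)
Lemma reduced_idem_central (e y : S) : e * e = e -> e * y = y * e.
Proof.
move=> ee; transitivity (e * y * e).
  apply/eqP; rewrite -subr_eq0; apply/eqP/redS.
  have -> : e * y - e * y * e = e * y * (1 - e) by rewrite mulrBr mulr1.
  have e0 : (1 - e) * e = 0 by rewrite mulrBl mul1r ee subrr.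
  by rewrite !mulrA -(mulrA _ _ e) e0 mulr0 !mul0r.
apply/esym/eqP; rewrite -subr_eq0; apply/eqP/redS.
have -> : y * e - e * y * e = (1 - e) * (y * e) by rewrite mulrBl mul1r mulrA.
have e0 : e * (1 - e) = 0 by rewrite mulrBr mulr1 ee subrr.
by rewrite !mulrA -(mulrA _ e) e0 mulr0 !mul0r.
Qed.

Lemma cube_char2_boolean : 2%:R = 0 :> S -> boolean_ring S.
Proof.
move=> S2 u; have u3 : u * u * u = u.
  rewrite -mulrA -expr2 -exprS; case: (cubeS u) => // ->.
  by apply/eqP; rewrite eq_sym -addr_eq0 -mulr2n natr_mul0.
apply/eqP; rewrite -subr_eq0; apply/eqP/redS.
rewrite expr2 mulrBl !mulrBr !mulrA u3 opprB -mulr2n.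
exact: natr_mul0.
Qed.

(** Here (u + 1)^3 = u^3 + 1.  If u^3 = -u this is 1 - u, and comparing it with
    u + 1 and -(u + 1) gives u = 0 or 1 = 0. *)
Lemma cube_char3 : 3%:R = 0 :> S -> forall u : S, u ^+ 3 = u.
Proof.
move=> S3 u; case: (cubeS u) => // u3.
have eN v : v *+ 2 = - v :> S.
  by apply/eqP; rewrite -addr_eq0 -mulrSr natr_mul0.
have v3 : (u + 1) ^+ 3 = 1 - u.
  rewrite exprS sqrrD1 eN mulrDl mul1r !mulrDr mulrN mulr1 -expr2 -exprS u3.
  by rewrite [- u - _ + u]addrAC addNr sub0r !addrA addNr add0r addrC.
have [] := cubeS (u + 1); rewrite v3.
  rewrite addrC => /addIr uN; have : u *+ 2 = 0 by rewrite mulr2n -{1}uN addNr.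
  by rewrite eN => /eqP; rewrite oppr_eq0 => /eqP u0; rewrite u0 expr0n.
rewrite opprD addrC => /addrI S1.
have one0 : 1 = 0 :> S.
  by apply: oppr_inj; rewrite oppr0 -eN mulr2n {1}S1 addNr.
by rewrite -[LHS]mulr1 -[RHS]mulr1 one0 !mulr0.
Qed.

(** The square of u is a central idempotent, so u r = u^3 r = u r u^2.  This
    puts u r in every left ideal that contains u. *)
Lemma cube_mulE : (forall u : S, u ^+ 3 = u) ->
  forall u r : S, u * r = u * r * u * u.
Proof.
move=> u3 u r; have uuu (v : S) : v * v * v = v.
  by rewrite -[RHS]u3 !exprS mulr1 mulrA.
have uur := @reduced_idem_central (u * u) r.
by rewrite -!mulrA -uur ?mulrA ?uuu // mulrA.
Qed.

Section Char5.
Hypothesis S5 : 5%:R = 0 :> S.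

(** The cube of e + 1 is 7 e + 1 = 2 e + 1.  Equal to e + 1, it gives e = 0;
    equal to -(e + 1), it gives 3 e + 2 = 0, which doubled is e + 4 = 0. *)
Lemma cube_char5_idem (e : S) : e * e = e -> e = 0 \/ e = 1.
Proof.
move=> ee.
have e3 : (e + 1) ^+ 3 = e *+ 2 + 1.
  rewrite exprS sqrrD1 expr2 ee -mulrS mulrDl mul1r mulrDr mulr1 mulrnAr ee.
  rewrite -mulrSr addrA -mulrnDr -[(4 + 3)%N]/(5 + 2)%N mulrnDr.
  by rewrite (natr_mul0 e S5) add0r.
have [] := cubeS (e + 1); rewrite e3.
  by move=> /addIr; rewrite mulr2n => e2; left; apply: (addrI e); rewrite addr0.
move=> /eqP; rewrite -addr_eq0 addrACA -mulrSr -mulr2n => /eqP e32; right.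
have := congr1 (fun z => z *+ 2) e32; rewrite mul0rn mulrnDl -!mulrnA.
rewrite -[(3 * 2)%N]/(5 + 1)%N -[(2 * 2)%N]/4%N mulrnDr.
rewrite (natr_mul0 e S5) add0r mulr1n => e4.
by apply: (addIr 4%:R); rewrite e4 -mulrS S5.
Qed.

(** The power u^4 is idempotent and u^5 = u, so each element is zero or has
    u^4 = 1.  Hence there are no zero divisors, and u^2 is 1 = 1^2 or -1 = 2^2;
    in both cases u is determined up to sign. *)
Lemma cube_char5_natr (u : S) : exists c : nat, u = c%:R.
Proof.
have u5 v : v ^+ 5 = v :> S.
  by rewrite (exprD v 2 3); have [v3|v3] := cubeS v;
    rewrite v3 ?mulrN -exprSr v3 ?opprK.
have unitP v : v = 0 \/ v ^+ 4 = 1 :> S.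
  have [|v40|] := @cube_char5_idem (v ^+ 4); [|left|by right].
    by rewrite -exprD (exprD v 5 3) u5 -exprS.
  by rewrite -(u5 v) exprS v40 mulr0.
have dom v w : v * w = 0 -> v = 0 \/ w = 0 :> S.
  case: (unitP v) => [|v4 vw]; [by left | right].
  by rewrite -[w]mul1r -v4 exprSr -mulrA vw mulr0.
have roots k : u ^+ 2 = (k * k)%:R -> u = k%:R \/ u = - k%:R.
  move=> u2; have [||/eqP] := @dom (u - k%:R) (u + k%:R).
  - rewrite mulrDr !mulrBl -expr2 u2 -(commr_nat u) addrA subrK.
    by rewrite -natrM subrr.
  - by move=> /eqP; rewrite subr_eq0 => /eqP; left.
  - by rewrite addr_eq0 => /eqP; right.
have negP k : (k <= 5)%N -> - k%:R = (5 - k)%:R :> S.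
  by move=> k5; rewrite natrB // S5 sub0r.
have [->|u4] := unitP u; first by exists 0%N.
have [u3|u3] := cubeS u.
  have u2 : u ^+ 2 = 1 by rewrite -u4 (exprS u 3) u3 expr2.
  by have [//|->|->] := roots 1%N; [exists 1%N | rewrite negP //; eexists].
have u2 : u ^+ 2 = - 1 by rewrite -u4 (exprS u 3) u3 mulrN opprK expr2.
have [|->|->] := roots 2%N; [|by exists 2%N|by rewrite negP //; eexists].
by rewrite u2 (negP 1%N).
Qed.
End Char5.
End CubeRings.

(** * Residue maps to Z_p *)

Section ResidueMorphism.
Variables (S : pzRingType) (p : nat) (I : set S).
Hypotheses (p_pr : prime p) (idI : left_ideal I).
Hypothesis idrI : forall u v, I u -> I (u * v).
Hypotheses (nI1 : ~ I 1) (Ip : I p%:R).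
Hypothesis resI : forall u, exists c : nat, I (u - c%:R).

Lemma residue_natr k : I k%:R <-> (p %| k)%N.
Proof.
split=> [Ik|/dvdnP[q ->]]; last by rewrite natrM; case: idI => _ _; apply.
apply: contrapT => npk; apply: nI1.
apply: (@left_ideal_coprime _ _ p k) => //.
by rewrite coprimezE /= prime_coprime //; apply/negP.
Qed.

Lemma residue_natr_eq k l : I (k%:R - l%:R) -> k%:R = l%:R :> 'Z_p.
Proof.
wlog lk : k l / (l <= k)%N => [IH Ikl|].
  have [/IH|/ltnW /IH kl] := leqP l k; first exact.
  by apply/esym/kl; rewrite -opprB; apply: left_idealN.
rewrite -natrB // => /residue_natr pkl; apply/eqP; rewrite -subr_eq0 -natrB //.
by rewrite -val_eqE /= val_Zp_nat ?prime_gt1.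
Qed.

(** If the naturals represent all classes modulo the proper two-sided ideal I,
    then S/I is Z_p, and a choice of representatives is a morphism. *)
Lemma residue_morphism :
  exists f : {rmorphism S -> 'Z_p}, forall u, f u = 0 <-> I u.
Proof.
have [I0 IB IZ] := idI.
have [c cP] := choice resI.
pose f u : 'Z_p := (c u)%:R.
have fE u k : I (u - k%:R) -> f u = k%:R.
  move=> Iuk; apply: residue_natr_eq.
  have -> : (c u)%:R - k%:R = (u - k%:R) - (u - (c u)%:R).
    by rewrite opprB [RHS]addrC addrA subrK.
  exact: IB.
have fD : nmod_morphism f.
  split=> [|u v]; first by rewrite (fE 0 0%N) ?subr0.
  rewrite -natrD; apply: fE; rewrite natrD opprD addrACA.
  exact: left_idealD.
have fM : monoid_morphism f.
  split=> [|u v]; first by rewrite (fE 1 1%N) // subrr.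
  rewrite -natrM; apply: fE.
  have -> : u * v - (c u * c v)%:R
      = (u - (c u)%:R) * v + (c u)%:R * (v - (c v)%:R).
    by rewrite natrM mulrBl mulrBr addrA subrK.
  by apply: left_idealD => //; [exact: idrI | exact: IZ].
exists (HB.pack_for {rmorphism S -> 'Z_p} f
  (GRing.isNmodMorphism.Build _ _ f fD)
  (GRing.isMonoidMorphism.Build _ _ f fM)).
move=> u /=; split=> [fu0|Iu]; last by rewrite (fE u 0%N) ?subr0.
apply: (left_ideal_congr idI (cP u)); apply/residue_natr.
by rewrite /dvdn -(val_Zp_nat (prime_gt1 p_pr)) -/(f u) fu0.
Qed.

End ResidueMorphism.

(** * Peirce decomposition along a central idempotent *)

Record central_idempotent (R : pzRingType) := CentralIdempotent {
  ci_val : R;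
  ci_idem : ci_val * ci_val = ci_val;
  ci_comm : forall x, ci_val * x = x * ci_val }.

Section Corner.
Variables (R : pzRingType) (c : central_idempotent R).
Local Notation e := (ci_val c).

Definition in_corner : {pred R} := fun x => e * x == x.

Lemma in_cornerP x : reflect (e * x = x) (x \in in_corner).
Proof. exact: eqP. Qed.

Lemma in_corner_zmod_closed : zmod_closed in_corner.
Proof.
split=> [|x y /in_cornerP ex /in_cornerP ey]; apply/in_cornerP.
  by rewrite mulr0.
by rewrite mulrBr ex ey.
Qed.

HB.instance Definition _ :=
  GRing.isZmodClosed.Build R in_corner in_corner_zmod_closed.

(** The ring e R, whose unit is e.  The type depends on the proofs bundled in
    [c], so that its ring structure can be inferred. *)
Record corner := Corner { corner_val : R; _ : corner_val \in in_corner }.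
HB.instance Definition _ := [isSub for corner_val].
HB.instance Definition _ := [Choice of corner by <:].
HB.instance Definition _ := [SubChoice_isSubZmodule of corner by <:].

Fact in_corner_proj x : e * x \in in_corner.
Proof. by apply/in_cornerP; rewrite mulrA ci_idem. Qed.

Definition corner_proj x : corner := Corner (in_corner_proj x).

Definition corner_mul (u v : corner) := corner_proj (val u * val v).

Lemma corner_valP (u : corner) : e * corner_val u = corner_val u.
Proof. by apply/in_cornerP; exact: valP. Qed.

Lemma corner_mulE u v : val (corner_mul u v) = val u * val v.
Proof. by rewrite /= mulrA corner_valP. Qed.

Lemma corner_mulA : associative corner_mul.
Proof. by move=> u v w; apply: val_inj; rewrite !corner_mulE mulrA. Qed.

Lemma corner_mul1l : left_id (corner_proj 1) corner_mul.
Proof.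
by move=> u; apply: val_inj; rewrite corner_mulE /= mulr1 corner_valP.
Qed.

Lemma corner_mul1r : right_id (corner_proj 1) corner_mul.
Proof.
by move=> u; apply: val_inj; rewrite corner_mulE /= mulr1 -ci_comm corner_valP.
Qed.

Lemma corner_mulDl : left_distributive corner_mul +%R.
Proof.
by move=> u v w; apply: val_inj; rewrite raddfD /= -mulrDr -mulrDl.
Qed.

Lemma corner_mulDr : right_distributive corner_mul +%R.
Proof.
by move=> u v w; apply: val_inj; rewrite raddfD /= -!mulrDr.
Qed.

HB.instance Definition _ := GRing.Zmodule_isPzRing.Build corner
  corner_mulA corner_mul1l corner_mul1r corner_mulDl corner_mulDr.

Fact corner_proj_zmod_morphism : zmod_morphism corner_proj.
Proof. by move=> x y; apply: val_inj; rewrite raddfB /= mulrBr. Qed.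
HB.instance Definition _ :=
  GRing.isZmodMorphism.Build R corner corner_proj corner_proj_zmod_morphism.

Fact corner_proj_monoid_morphism : monoid_morphism corner_proj.
Proof.
split=> // x y; apply: val_inj; rewrite /= -[in RHS]mulrA (mulrA x).
by rewrite -(ci_comm c x) !mulrA ci_idem ci_idem.
Qed.
HB.instance Definition _ :=
  GRing.isMonoidMorphism.Build R corner corner_proj corner_proj_monoid_morphism.

Lemma corner_projK (u : corner) : corner_proj (val u) = u.
Proof. by apply: val_inj; exact: corner_valP. Qed.

Lemma corner_proj_eq0 x : (corner_proj x == 0) = (e * x == 0).
Proof. by rewrite -val_eqE. Qed.

Fact compl_idem : (1 - e) * (1 - e) = 1 - e :> R.
Proof. by rewrite mulrBl mul1r mulrBr mulr1 ci_idem subrr subr0. Qed.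

Fact compl_comm x : (1 - e) * x = x * (1 - e).
Proof. by rewrite mulrBl mulrBr mul1r mulr1 ci_comm. Qed.

Definition ci_compl := CentralIdempotent compl_idem compl_comm.

End Corner.

(** The inverse of x |-> (e x, (1 - e) x) is addition, as e (1 - e) = 0. *)
Lemma peirce_isomorphic (R : pzRingType) (c : central_idempotent R) :
  ring_isomorphic R (corner c * corner (ci_compl c))%type.
Proof.
pose f x := (corner_proj c x, corner_proj (ci_compl c) x).
have fB : zmod_morphism f by move=> x y; rewrite /f !raddfB.
have fM : monoid_morphism f.
  by split=> [|x y]; rewrite /f ?rmorph1 ?rmorphM.
exists (HB.pack_for
  {rmorphism R -> (corner c * corner (ci_compl c))%type} f
  (GRing.isZmodMorphism.Build _ _ f fB)
  (GRing.isMonoidMorphism.Build _ _ f fM)).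
exists (fun u => val u.1 + val u.2) => [x|[u v]] /=.
  by rewrite mulrBl mul1r addrC subrK.
have uE := corner_valP u; have /= vE := corner_valP v.
rewrite /f; congr (_, _); apply: val_inj; rewrite /= mulrDr.
  by rewrite uE -vE mulrA mulrBr mulr1 ci_idem subrr mul0r addr0.
by rewrite vE -uE mulrA mulrBl mul1r ci_idem subrr mul0r add0r.
Qed.

(** * Transfer of nilpotence along morphisms *)

Lemma nilpotent_morph (R S : pzRingType) (f : {rmorphism R -> S}) x :
  nilpotent x -> nilpotent (f x).
Proof. by case=> n xn0; exists n; rewrite -rmorphXn xn0 rmorph0. Qed.

Lemma nilpotent_inj (R S : pzRingType) (f : {rmorphism R -> S}) x :
  injective f -> nilpotent (f x) -> nilpotent x.
Proof.
by move=> f_inj [n fxn0]; exists n; apply: f_inj; rewrite rmorphXn fxn0 rmorph0.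
Qed.

Lemma yaqub_nil_clean_surj (R S : pzRingType) (f : {rmorphism R -> S}) :
  (forall y, exists x, f x = y) -> yaqub_nil_clean R -> yaqub_nil_clean S.
Proof.
move=> f_surj ycR y; have [x <-] := f_surj y.
rewrite -rmorphXn -rmorphD -rmorphB.
by case: (ycR x) => nx; [left | right]; apply: nilpotent_morph.
Qed.

Lemma yaqub_nil_clean_inj (R S : pzRingType) (f : {rmorphism R -> S}) :
  injective f -> yaqub_nil_clean S -> yaqub_nil_clean R.
Proof.
move=> f_inj ycS x.
case: (ycS (f x)); rewrite -rmorphXn -?rmorphD -?rmorphB => nfx; [left | right];
  exact: nilpotent_inj nfx.
Qed.

Lemma yaqub_nil_clean_isomorphic (R S : pzRingType) :
  ring_isomorphic R S -> yaqub_nil_clean S -> yaqub_nil_clean R.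
Proof. by move=> [f /bij_inj f_inj]; exact: yaqub_nil_clean_inj f_inj. Qed.

Lemma nilpotent_pair (R S : pzRingType) (x : R) (y : S) :
  nilpotent x -> nilpotent y -> nilpotent ((x, y) : (R * S)%type).
Proof.
move=> [m xm0] [n yn0]; exists (m + n)%N.
have pairX k : ((x, y) : (R * S)%type) ^+ k = (x ^+ k, y ^+ k).
  by elim: k => // k IHk; rewrite !exprS IHk.
by rewrite pairX !exprD xm0 yn0 mul0r mulr0.
Qed.

(** * From the quotient by a nil radical back to the ring *)

Section JacobsonNil.
Variable R : pzRingType.
Hypothesis nilJ : nil_jacobson R.

Lemma nilpotent_of_jpi (x : R) : jpi x = 0 -> nilpotent x.
Proof. by move=> /eqP; rewrite jpi_eq0 => /nilJ. Qed.

Lemma cube_nilpotentB (x : R) : (jpi x) ^+ 3 = jpi x -> nilpotent (x - x ^+ 3).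
Proof.
by move=> x3; apply: nilpotent_of_jpi; rewrite rmorphB rmorphXn x3 subrr.
Qed.

Lemma cube_nilpotentD (x : R) :
  (jpi x) ^+ 3 = - jpi x -> nilpotent (x + x ^+ 3).
Proof.
by move=> x3; apply: nilpotent_of_jpi; rewrite rmorphD rmorphXn x3 subrr.
Qed.

Lemma boolean_jquot_nilpotent (x : R) : boolean_ring (jquot R) ->
  nilpotent (x - x ^+ 3) /\ nilpotent (x + x ^+ 3).
Proof.
move=> boolR; have x3 (u : jquot R) : u ^+ 3 = u.
  by rewrite exprS boolR -expr2 boolR.
split; [exact: cube_nilpotentB | apply: cube_nilpotentD; rewrite x3].
by rewrite -[LHS]boolR -sqrrN boolR.
Qed.

Lemma yaqub_jquot_nilpotent (x : R) : yaqub_ring (jquot R) ->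
  nilpotent (x - x ^+ 3).
Proof.
move=> [I [f [f_inj _]]]; apply: cube_nilpotentB; apply: f_inj.
rewrite rmorphXn; apply/funext => i; rewrite !exprS expr0 mulr1 /=.
rewrite -[(_ * _) i]/(f (jpi x) i * (f (jpi x) i * f (jpi x) i)).
by case: (f (jpi x) i) => -[|[|[|//]]] ?; apply: val_inj.
Qed.

Lemma Z5_jquot_nilpotent (x : R) : ring_isomorphic (jquot R) 'Z_5 ->
  nilpotent (x - x ^+ 3) \/ nilpotent (x + x ^+ 3).
Proof.
move=> [f /bij_inj f_inj].
have [c3|c3] : f (jpi x) ^+ 3 = f (jpi x) \/ f (jpi x) ^+ 3 = - f (jpi x).
  by case: (f (jpi x)) => -[|[|[|[|[|//]]]]] ?;
    [left|left|right|right|left]; apply: val_inj.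
- by left; apply: cube_nilpotentB; apply: f_inj; rewrite rmorphXn.
- by right; apply: cube_nilpotentD; apply: f_inj; rewrite rmorphXn rmorphN.
Qed.

End JacobsonNil.

(** * Yaqub nil-clean rings in which 2, 3 or 5 is nilpotent *)

Section YaqubPrimary.
Variable R : pzRingType.
Hypothesis ycR : yaqub_nil_clean R.

Lemma yaqub_nil_clean_char2 : nilpotent (2%:R : R) -> boolean_ring (jquot R).
Proof.
move=> n2; exact: cube_char2_boolean (jquot_cube ycR) (jquot_reduced ycR)
  (jquot_natr0 ycR n2).
Qed.

Section Char3.
Hypothesis n3 : nilpotent (3%:R : R).
Variables (M : set R) (maxM : maximal_left_ideal M).
(** The image of M in R/J: since J is contained in M, membership does not depend
    on the representative. *)
Let I : set (jquot R) := [set u | M (repr u)].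

Let cube (u : jquot R) : u ^+ 3 = u.
Proof. exact: cube_char3 (jquot_cube ycR) (jquot_natr0 ycR n3) u. Qed.

Let I_jpi x : I (jpi x) <-> M x.
Proof.
have idM := maximal_left_ideal_id maxM.
have Mxx : M (repr (jpi x) - x).
  by apply: (jacobson_sub_maximal maxM); rewrite -jpi_eq jpi_repr.
split; last exact: left_ideal_congr Mxx.
move=> Ix; apply: (left_ideal_congr idM _ Ix).
by rewrite -opprB; apply: left_idealN.
Qed.

Let idI : left_ideal I.
Proof.
have [M0 MB MZ] := maximal_left_ideal_id maxM.
split=> [|u v|u v].
- by rewrite -(raddf0 (@jpi R)); apply/I_jpi.
- rewrite -[u]jpi_repr -[v]jpi_repr -raddfB /= => /I_jpi Mu /I_jpi Mv.
  by apply/I_jpi; apply: MB.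
- rewrite -[u]jpi_repr -[v]jpi_repr -rmorphM /= => /I_jpi Mv.
  by apply/I_jpi; apply: MZ.
Qed.

Let idrI u v : I u -> I (u * v).
Proof.
move=> Iu; rewrite (cube_mulE (jquot_reduced ycR) cube).
by case: idI => _ _; apply.
Qed.

(** If u is not in I, it has a left inverse w modulo I, and v = w u v modulo I
    because I is two-sided. *)
Let primeI u v : I (u * v) -> I u \/ I v.
Proof.
move=> Iuv; have [Iu|nIu] := pselect (I u); [by left | right].
have [r Mr] := maximal_left_ideal_inv maxM nIu.
have : I ((jpi r * u - 1) * v).
  apply: idrI; rewrite -[u]jpi_repr -rmorphM -(rmorph1 (@jpi R)) -raddfB /=.
  exact/I_jpi.
rewrite mulrBl mul1r -mulrA => Iv.
apply: (left_ideal_congr idI (y := jpi r * (u * v))).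
  by rewrite -opprB; apply: left_idealN.
by case: idI => _ _; apply.
Qed.

(** By [primeI], the identity u (u - 1) (u + 1) = 0 puts one of u, u - 1 and
    u - 2 in the ideal. *)
Lemma yaqub_residue3 :
  exists f : {rmorphism jquot R -> 'Z_3}, forall u, f u = 0 <-> M (repr u).
Proof.
have S3 := jquot_natr0 ycR n3; have [I0 _ _] := idI.
apply: (@residue_morphism _ 3 I) => // [I1|| u].
- by apply: (maximal_left_ideal_not1 maxM); apply/I_jpi; rewrite rmorph1.
- by rewrite S3.
have : I (u * (u - 1) * (u + 1)).
  by rewrite -mulrA -subr_sqr_1 mulrBr mulr1 -exprS cube subrr.
case/primeI => [/primeI[Iu|Iu]|Iu].
- by exists 0%N; rewrite subr0.
- by exists 1%N.
- by exists 2%N; rewrite -[2]opprK -[- 2]add0r -S3 -natrB // opprK.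
Qed.

End Char3.

(** J is the intersection of the maximal left ideals, so their residue maps to
    Z_3 are jointly injective on R/J. *)
Lemma yaqub_nil_clean_char3 : nilpotent (3%:R : R) -> yaqub_ring (jquot R).
Proof.
move=> n3; pose I := {M : set R | maximal_left_ideal M}.
have resI (M : I) := yaqub_residue3 n3 (svalP M).
have [f fP] := choice resI.
pose F (u : jquot R) (M : I) : 'Z_3 := f M u.
have FB : zmod_morphism F by move=> u v; apply/funext => M; rewrite /F raddfB.
have FM : monoid_morphism F.
  by split=> [|u v]; apply/funext => M; rewrite /F ?rmorph1 ?rmorphM.
exists I, (HB.pack_for {rmorphism jquot R -> (I -> 'Z_3)} F
  (GRing.isZmodMorphism.Build _ _ F FB)
  (GRing.isMonoidMorphism.Build _ _ F FM)).
split=> [|M k]; last first.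
  by exists k%:R; exact: etrans (rmorph_nat (f M) k) (natr_Zp k).
apply: raddf_inj => u /= Fu0; apply/eqP; rewrite -[u]jpi_repr jpi_eq0.
apply/jacobsonP => M maxM; apply/(fP (exist _ M maxM)).
by rewrite -[LHS]/(F u _) Fu0.
Qed.

Lemma yaqub_nil_clean_char5 : nilpotent (5%:R : R) -> 1 <> 0 :> R ->
  ring_isomorphic (jquot R) 'Z_5.
Proof.
move=> n5 R1; have S5 := jquot_natr0 ycR n5.
have [f fP] : exists f : {rmorphism jquot R -> 'Z_5},
    forall u, f u = 0 <-> [set 0] u.
  apply: residue_morphism => //.
  - split=> [//|u v -> ->|u v ->]; first exact: subr0.
    exact: mulr0.
  - by move=> u v ->; exact: mul0r.
  - rewrite -(rmorph1 (@jpi R)) => /eqP; rewrite jpi_eq0.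
    by case/(yaqub_nil_jacobson ycR) => n; rewrite expr1n.
  - move=> u; have [c ->] := cube_char5_natr (jquot_cube ycR) S5 u.
    by exists c; exact: subrr.
have f_inj : injective f by apply: raddf_inj => u /fP.
have natf (k : 'Z_5) : f k%:R = k := etrans (rmorph_nat f k) (natr_Zp k).
by exists f, (fun k : 'Z_5 => k%:R) => // u; apply: f_inj; rewrite natf.
Qed.

End YaqubPrimary.

(** * Splitting off the primary parts *)

Lemma yaqub_nil_clean_Z3 : yaqub_nil_clean 'Z_3.
Proof.
by move=> [[|[|[|//]]] ?]; right; exists 1%N; apply: val_inj.
Qed.

Lemma yaqub_nil_clean_Z5 : yaqub_nil_clean 'Z_5.
Proof.
by move=> [[|[|[|[|[|//]]]]] ?]; [right|right|left|left|right];
  exists 1%N; apply: val_inj.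
Qed.

(** A Bezout relation u n = v m + 1 makes e = u n idempotent, and m e and
    n (1 - e) are multiples of m n = 0. *)
Lemma peirce_coprime (R : pzRingType) (m n : nat) :
  (0 < n)%N -> coprime m n -> (m * n)%:R = 0 :> R ->
  exists c : central_idempotent R,
    m%:R = 0 :> corner c /\ n%:R = 0 :> corner (ci_compl c).
Proof.
move=> n_gt0 cop mn0.
have [u v uv _] := egcdnP m n_gt0; rewrite gcdnC (eqP cop) in uv.
pose e : R := (u * n)%:R.
have eE : e = (v * m)%:R + 1 by rewrite /e uv natrD.
have e_idem : e * e = e.
  rewrite {2}eE mulrDr mulr1 /e -natrM mulnACA (mulnC n).
  by rewrite natrM mn0 mulr0 add0r.
have e_comm x : e * x = x * e by exact: commr_sym (commr_nat _ _).
exists (CentralIdempotent e_idem e_comm); split; apply/eqP.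
  rewrite -(rmorph_nat (corner_proj _)) corner_proj_eq0 /=.
  by rewrite /e -natrM -mulnA (mulnC n) natrM mn0 mulr0.
rewrite -(rmorph_nat (corner_proj _)) corner_proj_eq0 /=.
rewrite eE opprD addrCA subrr addr0 mulNr -natrM -mulnA.
by rewrite natrM mn0 mulr0 oppr0.
Qed.

Theorem theorem3p1 (R : pzRingType) :
  yaqub_nil_clean R <->
  exists R1 R2 R3 : pzRingType,
    [/\ boolean_ring (jquot R1) /\ nil_jacobson R1,
        yaqub_ring (jquot R2) /\ nil_jacobson R2,
        ring_isomorphic (jquot R3) 'Z_5 /\ nil_jacobson R3
      & ring_isomorphic R R1 \/ ring_isomorphic R R2 \/ ring_isomorphic R R3 \/
        ring_isomorphic R (R1 * R2)%type \/ ring_isomorphic R (R1 * R3)%type].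
Proof.
have good2 S : yaqub_nil_clean S -> nilpotent (2%:R : S) ->
    boolean_ring (jquot S) /\ nil_jacobson S.
  move=> ycS n2; split; last exact: yaqub_nil_jacobson.
  exact: yaqub_nil_clean_char2.
have good3 S : yaqub_nil_clean S -> nilpotent (3%:R : S) ->
    yaqub_ring (jquot S) /\ nil_jacobson S.
  move=> ycS n3; split; last exact: yaqub_nil_jacobson.
  exact: yaqub_nil_clean_char3.
have good5 S : yaqub_nil_clean S -> nilpotent (5%:R : S) -> 1 <> 0 :> S ->
    ring_isomorphic (jquot S) 'Z_5 /\ nil_jacobson S.
  move=> ycS n5 S1; split; last exact: yaqub_nil_jacobson.
  exact: yaqub_nil_clean_char5.
split=> [ycR|[R1 [R2 [R3 [[b1 J1] [y2 J2] [z3 J3]]]]]]; last first.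
  have yc1 (x : R1) := boolean_jquot_nilpotent J1 x b1.
  have yc2 (x : R2) := yaqub_jquot_nilpotent J2 x y2.
  have yc3 (x : R3) := Z5_jquot_nilpotent J3 x z3.
  move=> [|[|[|[]]]] /yaqub_nil_clean_isomorphic; apply.
  - by move=> x; right; case: (yc1 x).
  - by move=> x; right.
  - by move=> x; case: (yc3 x); [right | left].
  - move=> [x y]; right; have [nx _] := yc1 x.
    exact: nilpotent_pair nx (yc2 y).
  - move=> [x y]; have [nx nx'] := yc1 x.
    by case: (yc3 y) => ny; [right; exact: nilpotent_pair nx ny
      | left; exact: nilpotent_pair nx' ny].
(* Z_3 and Z_5 fill the places of the factors that do not occur in R. *)
have Z3P : yaqub_ring (jquot 'Z_3) /\ nil_jacobson 'Z_3.
  by apply: good3; [exact: yaqub_nil_clean_Z3 | exists 1%N; apply: val_inj].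
have Z5P : ring_isomorphic (jquot 'Z_5) 'Z_5 /\ nil_jacobson 'Z_5.
  by apply: good5; [exact: yaqub_nil_clean_Z5 | exists 1%N; apply: val_inj | ].
have ycC (c : central_idempotent R) : yaqub_nil_clean (corner c).
  apply: (@yaqub_nil_clean_surj _ _ (corner_proj c)) ycR.
  by move=> u; exists (val u); exact: corner_projK.
have splitR p : coprime 2 p -> (0 < p)%N -> nilpotent ((2 * p)%:R : R) ->
    exists c : central_idempotent R, nilpotent (2%:R : corner c) /\
      nilpotent (p%:R : corner (ci_compl c)).
  move=> cop p_gt0 [n]; rewrite -natrX expnMn.
  case/peirce_coprime => [||c [c2 cp]].
  - by rewrite expn_gt0 p_gt0.
  - by rewrite coprimeXl ?coprimeXr.
  by exists c; split; exists n; rewrite -natrX.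
have [n6|n10] := yaqub_nil_clean_6_or_10 ycR.
  have [c [n2 n3]] := splitR 3%N isT isT n6.
  exists (corner c), (corner (ci_compl c)), 'Z_5.
  split=> //; [exact: good2 | exact: good3 | ].
  by do 3 right; left; exact: peirce_isomorphic.
have [c [n2 n5]] := splitR 5%N isT isT n10.
(* When the 5-part is zero its quotient is not Z_5, and R is its 2-part. *)
have [c1|c1] := pselect (1 = 0 :> corner (ci_compl c)).
  have nR : nilpotent (2%:R : R).
    have [f f_bij] := peirce_isomorphic c.
    apply: (nilpotent_inj (bij_inj f_bij)); rewrite rmorph_nat.
    have -> : 2%:R = (2%:R, 0) :> (corner c * corner (ci_compl c))%type.
      by congr (_, _); rewrite -[LHS]mulr1 c1 mulr0.
    by apply: nilpotent_pair n2 _; exists 1%N.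
  exists R, 'Z_3, 'Z_5; split=> //; [exact: good2 | left].
  by exists idfun; exists idfun.
exists (corner c), 'Z_3, (corner (ci_compl c)).
split=> //; [exact: good2 | exact: good5 | ].
by do 4 right; exact: peirce_isomorphic.
Qed.
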